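(* Let $X$ be a real Hilbert space, let $A,B\colon X\rightrightarrows X$ be maximally monotone, and let $\beta>0$. Suppose that $A$ is $\beta$-cocoercive and that $B$ is uniformly monotone. Let $\gamma\in\,]0,2\beta[$ and set $T=J_{\gamma B}(\mathrm{Id}-\gamma A)$. Let $x_0\in X$ and set $x_{n+1}=Tx_n$ for every $n\in\mathbb{N}$. Then the following hold: (i) $\operatorname{zer}(A+B)$ is a singleton. (ii) $T$ is a contraction for large distances. (iii) $(x_n)_{n\in\mathbb{N}}$ converges strongly to the unique point in $\operatorname{zer}(A+B)$.
   Context: $A$ is $\beta$-cocoercive if $A$ is a single-valued map $A\colon X\to X$ with $\langle x-y,Ax-Ay\rangle\ge\beta\|Ax-Ay\|^2$ for all $x,y\in X$. For $B\colon X\rightrightarrows X$, $\operatorname{gra}B=\{(x,x^* )\in X\times X : x^*\in Bx\}$. A modulus is an increasing (nondecreasing) function $\phi\colon[0,\infty)\to[0,+\infty]$ that vanishes only at $0$. $B$ is uniformly monotone if there is a modulus $\phi$ such that $\langle x-y,x^*-y^*\rangle\ge\phi(\|x-y\|)$ for all $(x,x^* ),(y,y^* )\in\operatorname{gra}B$. $J_{\gamma B}=(\mathrm{Id}+\gamma B)^{-1}$ is the resolvent of $\gamma B$, single-valued and defined on all of $X$ for maximally monotone $B$. $\operatorname{zer}(A+B)=\{x\in X: 0\in Ax+Bx\}$. $T\colon X\to X$ is a contraction for large distances if for each $\epsilon>0$ there exists $K_\epsilon<1$ such that $\|Tx-Ty\|\le K_\epsilon\|x-y\|$ whenever $\|x-y\|\ge\epsilon$.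 *)

(* Defs.v *)
From HB Require Import structures.
From mathcomp Require Import all_boot all_order all_algebra.
From mathcomp Require Import all_classical all_reals all_analysis.

Set Implicit Arguments.
Unset Strict Implicit.
Unset Printing Implicit Defensive.

Import Order.TTheory GRing.Theory Num.Theory.
Import numFieldNormedType.Exports.

Local Open Scope classical_set_scope.
Local Open Scope ring_scope.

(* Real Hilbert spaces: complete normed modules whose norm comes from a
   positive definite symmetric bilinear form. *)
HB.mixin Record CompleteNormedModule_isHilbert (R : realType) X
    of CompleteNormedModule R X := {
  inner : {dot X for idfun} ;
  inner_norm : forall x : X, inner x x = `|x| ^+ 2
}.

#[short(type="hilbertType")]
HB.structure Definition Hilbert (R : realType) :=
  {X of CompleteNormedModule R X & CompleteNormedModule_isHilbert R X}.

(* An operator X => X is a function X -> set X, identified with its graph. *)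
Section SetValuedOperators.
Context {R : realType} {X : hilbertType R}.
Implicit Types (A B : X -> set X) (c gamma : R).

Definition gra A : set (X * X) := [set p | A p.1 p.2].

Definition op_id : X -> set X := fun x => [set x].

Definition op_add A B : X -> set X :=
  fun x => [set u + v | u in A x & v in B x].

Definition op_scale c A : X -> set X := fun x => [set c *: u | u in A x].

Definition op_comp A B : X -> set X := fun x => \bigcup_(y in B x) A y.

Definition op_inv A : X -> set X := fun u => [set x | A x u].

Definition zer A : set X := [set x | A x 0].

Definition resolvent A : X -> set X := op_inv (op_add op_id A).

(* Meaningful when every [A x] is a singleton. *)
Definition op_fun A : X -> X := fun x => get (A x).

Definition monotone A : Prop := forall x y u v : X,
  gra A (x, u) -> gra A (y, v) -> 0 <= inner (x - y) (u - v).

Definition maximally_monotone A : Prop :=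
  monotone A /\
  forall B, monotone B -> gra A `<=` gra B -> gra B = gra A.

Definition cocoercive (beta : R) A : Prop :=
  exists2 f : X -> X, (forall x, A x = [set f x]) &
    forall x y, beta * `|f x - f y| ^+ 2 <= inner (x - y) (f x - f y).

(* Only the values of [phi] on [0, +oo[ matter. *)
Definition modulus (phi : R -> \bar R) : Prop :=
  [/\ forall t, 0 <= t -> (0 <= phi t)%E,
      forall s t, 0 <= s -> s <= t -> (phi s <= phi t)%E &
      forall t, 0 <= t -> phi t = 0%E <-> t = 0].

Definition uniformly_monotone A : Prop :=
  exists2 phi : R -> \bar R, modulus phi &
    forall x y u v : X, gra A (x, u) -> gra A (y, v) ->
      (phi `|x - y|%R <= (inner (x - y)%R (u - v)%R)%:E)%E.

Definition contraction_for_large_distances (T : X -> X) : Prop :=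
  forall eps : R, 0 < eps ->
    exists2 K : R, K < 1 &
      forall x y, eps <= `|x - y| -> `|T x - T y| <= K * `|x - y|.

(* J_(gamma B) (Id - gamma A) as a map: it is single-valued with full domain
   when [A] is single-valued, [B] is maximally monotone and [0 < gamma], by
   Minty's theorem. *)
Definition forward_backward gamma A B : X -> X :=
  op_fun (op_comp (resolvent (op_scale gamma B))
                  (op_add op_id (op_scale (- gamma) A))).

End SetValuedOperators.

(* Main.v *)
(* The fixed points of T = J_(gamma B) (Id - gamma A) are the zeros of A + B.
   For c <= phi |Tx - Ty|, uniform monotonicity of B and nonexpansiveness of
   Id - gamma A (cocoercivity and gamma < 2 beta) give
     gamma c <= |Tx - Ty| (|x - y| - |Tx - Ty|),
   which makes T a contraction with a factor K < 1 on the annulus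
   eps <= |x - y| <= 2 eps.  As T is defined on the whole of X, bisecting
   segments propagates K to all distances >= eps, although phi itself need not
   grow at infinity.  The Picard iterates of such a T converge to its only fixed
   point, as for Meir-Keeler contractions.

   That the resolvent of B has full domain is Minty's theorem, proved by
   minimizing the strongly convex function F(x, u) + (|x|^2 + |u|^2) / 2, where F
   is the Fitzpatrick function of B: if (x, u) is the minimizer, then
   x = - u, and (- u, - x) lies in the graph of B. *)

Require Import Defs.
From HB Require Import structures.
From mathcomp Require Import all_boot all_order all_algebra.
From mathcomp Require Import all_classical all_reals all_analysis.
From mathcomp Require Import ring lra.

Set Implicit Arguments.
Unset Strict Implicit.
Unset Printing Implicit Defensive.

Import Order.TTheory GRing.Theory Num.Theory.
Import numFieldNormedType.Exports.

Local Open Scope classical_set_scope.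
Local Open Scope ring_scope.

(** * Inner product identities *)

Section InnerProduct.
Context {R : realType} {X : hilbertType R}.
Implicit Types x y z : X.

Lemma innerC x y : inner x y = inner y x.
Proof. by have := hermC (inner : {dot X for idfun}) x y; rewrite /= expr0 mul1r. Qed.

Lemma innerDl x y z : inner (x + y) z = inner x z + inner y z.
Proof. exact: linearDl. Qed.

Lemma innerNl x z : inner (- x) z = - inner x z.
Proof. exact: linearNl. Qed.

Lemma innerZl (a : R) x z : inner (a *: x) z = a * inner x z.
Proof. exact: linearZl_LR. Qed.

Lemma inner0l z : inner 0 z = 0.
Proof. exact: linear0l. Qed.

Lemma innerDr x y z : inner z (x + y) = inner z x + inner z y.
Proof. by rewrite !(innerC z) innerDl. Qed.

Lemma inner0r z : inner z 0 = 0.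
Proof. by rewrite innerC inner0l. Qed.

Lemma innerNr x z : inner z (- x) = - inner z x.
Proof. by rewrite !(innerC z) innerNl. Qed.

Lemma innerZr (a : R) x z : inner z (a *: x) = a * inner z x.
Proof. by rewrite !(innerC z) innerZl. Qed.

Definition innerE := (innerDl, innerDr, innerNl, innerNr, innerZl, innerZr).

Lemma cauchy_schwarz x y : inner x y <= `|x| * `|y|.
Proof.
have [->|y0] := eqVneq y 0.
  by rewrite normr0 mulr0 inner0r.
have ny : 0 < `|y| by rewrite normr_gt0.
have [->|x0] := eqVneq x 0.
  by rewrite normr0 mul0r inner0l.
have nx : 0 < `|x| by rewrite normr_gt0.
(* The expansion is 2 |x| |y| (|x| |y| - <x, y>). *)
have := sqr_ge0 `|(`|y| *: x - `|x| *: y)|.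
rewrite -inner_norm !innerE !inner_norm (innerC y x) => h.
have nxy : 0 < `|x| * `|y| by rewrite mulr_gt0.
rewrite -(ler_pM2l nxy); nra.
Qed.

(** Strong convexity of the squared norm, as an equality; the shift [z] matches the terms of
    [fitzpatrick_sublevel]. *)
Lemma sqr_norm_conv (l : R) x y z :
  `|(1 - l) *: x + l *: y + z| ^+ 2 =
  (1 - l) * `|x + z| ^+ 2 + l * `|y + z| ^+ 2 - l * (1 - l) * `|x - y| ^+ 2.
Proof.
rewrite -!inner_norm !innerE (innerC y x) (innerC z x) (innerC z y); ring.
Qed.

End InnerProduct.

Lemma cauchy_seq_cvg (R : realType) (X : completeNormedModType R)
    (x : nat -> X) :
  (forall e : R, 0 < e -> exists N, forall n, (N <= n)%N -> `|x N - x n| <= e) ->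
  exists z : X, x @ \oo --> z.
Proof.
move=> hx; exists (lim (x @ \oo)); apply: cauchy_cvg; apply: cauchy_exP.
move=> e e0; have [N hN] := hx (e / 2) (divr_gt0 e0 (ltr0n _ 2)).
exists (x N); exists N => // n /= /hN h.
rewrite -ball_normE /=; apply: le_lt_trans h _.
by rewrite gtr_pMr // invf_lt1 // ltr1n.
Qed.

(** * Minty's theorem *)

Section Minty.
Context {R : realType} {X : hilbertType R}.
Context (G : X -> set X).

(* With F the Fitzpatrick function of [G], this says
   2 F(x, u) + |x|^2 + |u|^2 <= t: complete the squares in
   2 (<x, v> + <y, u> - <y, v>) + |x|^2 + |u|^2. *)
Definition fitzpatrick_sublevel (t : R) (x u : X) : Prop :=
  forall y v, G y v -> `|x + v| ^+ 2 + `|u + y| ^+ 2 - `|y + v| ^+ 2 <= t.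

Lemma fitzpatrick_sublevel_conv (l s t : R) x u x' u' : 0 <= l <= 1 ->
  fitzpatrick_sublevel s x u -> fitzpatrick_sublevel t x' u' ->
  fitzpatrick_sublevel
    ((1 - l) * s + l * t - l * (1 - l) * (`|x - x'| ^+ 2 + `|u - u'| ^+ 2))
    ((1 - l) *: x + l *: x') ((1 - l) *: u + l *: u').
Proof.
move=> /andP[l0 l1] hs ht y v Gyv; rewrite !sqr_norm_conv.
have := hs _ _ Gyv; have := ht _ _ Gyv.
move: (`|x + v| ^+ 2) (`|x' + v| ^+ 2) (`|u + y| ^+ 2) (`|u' + y| ^+ 2).
move: (`|y + v| ^+ 2) (`|x - x'| ^+ 2) (`|u - u'| ^+ 2) => c d e a a' b b' h h'.
have l1' : 0 <= 1 - l by rewrite subr_ge0.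
have := ler_wpM2l l0 h; have := ler_wpM2l l1' h'; lra.
Qed.

(** Each defining inequality is closed in (x, u); the slack is that of the minimizing sequence
    below. *)
Lemma fitzpatrick_sublevel_cvg (t : R) (xs us : nat -> X) x u :
  (forall n, fitzpatrick_sublevel (t + n.+1%:R^-1) (xs n) (us n)) ->
  xs @ \oo --> x -> us @ \oo --> u -> fitzpatrick_sublevel t x u.
Proof.
move=> hS cx cu y v Gyv.
have cl : (`|xs n + v| ^+ 2 + `|us n + y| ^+ 2 - `|y + v| ^+ 2) @[n --> \oo] -->
    `|x + v| ^+ 2 + `|u + y| ^+ 2 - `|y + v| ^+ 2.
  apply: cvgB; last exact: cvg_cst.
  by apply: cvgD; rewrite !expr2; apply: cvgM; apply: cvg_norm; apply: cvgD => //;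
    exact: cvg_cst.
have cr : (t + n.+1%:R^-1) @[n --> \oo] --> t.
  rewrite -[X in _ --> X]addr0; apply: cvgD; first exact: cvg_cst.
  exact: cvg_harmonic.
by apply: (ler_cvg_to cl cr); near=> n; exact: hS Gyv.
Unshelve. all: by end_near.
Qed.

Hypothesis monG : forall y v y' v', G y v -> G y' v' -> 0 <= inner (y - y') (v - v').
Hypothesis maxG : forall x u,
  (forall y v, G y v -> 0 <= inner (y - x) (v - u)) -> G x u.

(** Monotonicity, through the identity |x + v|^2 + |u + y|^2 - |y + v|^2 = |x + u|^2 - 2 <y - x, v -
    u>. *)
Lemma fitzpatrick_sublevel_graph y v : G y v ->
  fitzpatrick_sublevel (`|y + v| ^+ 2) y v.
Proof.
move=> Gyv y' v' Gyv'; have := monG Gyv Gyv'.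
rewrite -!inner_norm !innerE (innerC v y) (innerC v' y') (innerC v' y) (innerC v y'); lra.
Qed.

(* The Fitzpatrick function of a maximally monotone operator dominates the
   duality pairing. *)
Lemma fitzpatrick_sublevel_ge t x u :
  fitzpatrick_sublevel t x u -> `|x + u| ^+ 2 <= t.
Proof.
(* A graph point is tested against itself. For any other pair, maximality yields a graph point with
   <y - x, v - u> < 0, and the identity above applies. *)
move=> hS; case: (pselect (G x u)) => [/hS|nG].
  by rewrite (addrC u x) addrK.
case: (pselect (exists y v, G y v /\ inner (y - x) (v - u) < 0)); last first.
  move=> nex; exfalso; apply: nG; apply: maxG => y v Gyv.
  by rewrite leNgt; apply/negP => ?; apply: nex; exists y, v.
move=> [y [v [Gyv]]]; have := hS _ _ Gyv.
rewrite -!inner_norm !innerE (innerC v y) (innerC u x) (innerC v x) (innerC u y); lra.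
Qed.

Lemma fitzpatrick_sublevel_min : exists m x u, fitzpatrick_sublevel m x u /\
  forall s x' u', fitzpatrick_sublevel s x' u' -> m <= s.
Proof.
(* Every pair is vacuously related to an empty graph, so maximality excludes it. *)
have [y0 [v0 G0]] : exists y v, G y v.
  apply: contrapT => nG; apply: (nG); exists 0, 0; apply: maxG => y v Gyv.
  by case: nG; exists y, v.
pose E := [set t : R | exists x u, fitzpatrick_sublevel t x u].
have hE : has_inf E.
  split; first by exists (`|y0 + v0| ^+ 2), y0, v0; exact: fitzpatrick_sublevel_graph.
  by exists 0 => t [x [u /fitzpatrick_sublevel_ge]]; apply: le_trans; exact: sqr_ge0.
pose m := inf E.
have mE s x' u' : fitzpatrick_sublevel s x' u' -> m <= s.
  by move=> h; apply: ge_inf; [exact: hE.2 | exists x', u'].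
have /choice [p hp] : forall n, exists p : X * X,
    fitzpatrick_sublevel (m + n.+1%:R^-1) p.1 p.2.
  move=> n; have n0 : (0 : R) < n.+1%:R^-1 by rewrite invr_gt0.
  have [t [x [u h]] /ltW tm] := inf_adherent n0 hE.
  by exists (x, u) => y v /h /le_trans; apply.
clearbody m.
(* The midpoint value is at least m, so a quarter of the left side is at most the mean of the two
   slacks, hence at most 1 / (N + 1). *)
have dist N n : (N <= n)%N ->
    `|(p N).1 - (p n).1| ^+ 2 + `|(p N).2 - (p n).2| ^+ 2 <= 4 / N.+1%:R.
  move=> Nn; have half : 0 <= (1 / 2 : R) <= 1 by apply/andP; split; lra.
  have := mE _ _ _ (fitzpatrick_sublevel_conv half (hp N) (hp n)).
  have : (n.+1%:R : R)^-1 <= N.+1%:R^-1 by rewrite lef_pV2 ?posrE // ler_nat.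
  by move: (N.+1%:R^-1 : R) (n.+1%:R^-1 : R) {half} => a b; lra.
have small (e : R) : 0 < e -> exists N : nat, 4 / N.+1%:R <= e ^+ 2.
  move=> e0; have e4 : 0 < e ^+ 2 / 4 by rewrite divr_gt0 // exprn_gt0.
  have [N hN] := ltr_add_invr e4.
  by exists N; move: (N.+1%:R^-1 : R) hN => a; lra.
have [x cx] : exists x : X, (fun n => (p n).1) @ \oo --> x.
  apply: cauchy_seq_cvg => e e0; have [N hN] := small e e0; exists N => n /dist h.
  rewrite -(@ler_pXn2r _ 2) ?nnegrE ?normr_ge0 ?(ltW e0) //.
  by apply: le_trans (le_trans h hN); rewrite lerDl sqr_ge0.
have [u cu] : exists u : X, (fun n => (p n).2) @ \oo --> u.
  apply: cauchy_seq_cvg => e e0; have [N hN] := small e e0; exists N => n /dist h.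
  rewrite -(@ler_pXn2r _ 2) ?nnegrE ?normr_ge0 ?(ltW e0) //.
  by apply: le_trans (le_trans h hN); rewrite lerDr sqr_ge0.
exists m, x, u; split=> //; exact: fitzpatrick_sublevel_cvg hp cx cu.
Qed.

(** Only the value 0 of Id + G is treated; the others follow by translating and scaling the
    graph. *)
Lemma minty : exists p, G p (- p).
Proof.
have [m [x [u [hm mmin]]]] := fitzpatrick_sublevel_min.
have xum := fitzpatrick_sublevel_ge hm.
(* Strong convexity at the minimizer; the constant is obtained as [l] tends to 0. *)
have growth y v : G y v -> m + `|x - y| ^+ 2 + `|u - v| ^+ 2 <= `|y + v| ^+ 2.
  move=> Gyv.
  set d := `|x - y| ^+ 2 + `|u - v| ^+ 2.
  suff : d <= `|y + v| ^+ 2 - m by rewrite /d; lra.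
  have key (l : R) : 0 < l <= 1 -> (1 - l) * d <= `|y + v| ^+ 2 - m.
    move=> /andP[l0 l1]; have l01 : 0 <= l <= 1 by rewrite l1 ltW.
    have := mmin _ _ _ (fitzpatrick_sublevel_conv l01 hm (fitzpatrick_sublevel_graph Gyv)).
    rewrite -/d => h; rewrite -(ler_pM2l l0); lra.
  apply/ler_addgt0Pr => e e0.
  have d0 : 0 <= d by rewrite addr_ge0 // sqr_ge0.
  have de : 0 < d + e by lra.
  (* This [l] satisfies l d <= e and stays positive and at most 1 even when d = 0. *)
  have l01 : 0 < e / (d + e) <= 1.
    by rewrite divr_gt0 //= ler_pdivrMr // mul1r; lra.
  have := key _ l01.
  suff : e / (d + e) * d <= e by lra.
  by rewrite mulrAC ler_pdivrMr // ler_wpM2l ?ltW //; lra.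
(* From [growth] and |x + u|^2 <= m: the pair (- u, - x) is related to the graph, hence belongs to
   it, and testing it against itself forces x + u = 0. *)
have rel y v : G y v -> `|x + u| ^+ 2 <= inner (y - - u) (v - - x).
  move=> /growth; move: xum.
  rewrite -!inner_norm !innerE !opprK (innerC v y) (innerC u x) (innerC y x) (innerC v u); lra.
have Gux : G (- u) (- x).
  by apply: maxG => y v /rel; apply: le_trans; exact: sqr_ge0.
have := rel _ _ Gux; rewrite subrr inner0l => h.
have : `|x + u| == 0.
  by rewrite -sqrf_eq0; apply/eqP; apply/le_anti; rewrite h sqr_ge0.
rewrite normr_eq0 addr_eq0 => /eqP xu; exists (- u).
by rewrite -{2}xu.
Qed.

End Minty.

(** * Contractions for large distances and their Picard iterates *)

Section ContractionForLargeDistances.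
Context {R : realType} {X : hilbertType R}.
Context (T : X -> X).

Lemma contraction_for_large_distances_annulus :
  (forall eps : R, 0 < eps -> exists2 K : R, K < 1 &
     forall x y, eps <= `|x - y| <= 2 * eps -> `|T x - T y| <= K * `|x - y|) ->
  contraction_for_large_distances T.
Proof.
move=> hT eps eps0; have [K K1 hK] := hT eps eps0; exists K => //.
have dyadic k : forall x y, eps <= `|x - y| <= 2 ^+ k.+1 * eps ->
    `|T x - T y| <= K * `|x - y|.
  elim: k => [|k IH] x y; first by rewrite expr1; exact: hK.
  move=> /andP[lb ub]; have [small|/ltW big] := leP `|x - y| (2 * eps).
    by apply: hK; rewrite lb small.
  (* At the midpoint both halves have length |x - y| / 2 >= eps, within reach of [IH], and the
     triangle inequality keeps the same [K]. *)
  pose z := x - 2^-1 *: (x - y).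
  have xz : x - z = 2^-1 *: (x - y) by rewrite subKr.
  have zy : z - y = 2^-1 *: (x - y).
    by rewrite addrAC -{1}[x - y]scale1r -scalerBl; congr (_ *: _); lra.
  have n2 : `|2^-1 *: (x - y)| = `|x - y| / 2.
    by rewrite normrZ ger0_norm ?invr_ge0 // mulrC.
  have rng : eps <= `|x - y| / 2 <= 2 ^+ k.+1 * eps.
    by move: ub; rewrite exprS => ub; apply/andP; split; lra.
  have := IH x z; rewrite xz n2 => /(_ rng) h1.
  have := IH z y; rewrite zy n2 => /(_ rng) h2.
  have := ler_distD (T z) (T x) (T y); lra.
move=> x y lb; pose k := Num.bound (`|x - y| / eps).
apply: (dyadic k); rewrite lb /= -ler_pdivrMr //.
apply: le_trans (ltW (archi_boundP _)) _; first by rewrite divr_ge0 // ltW.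
by rewrite -natrX ler_nat (leq_trans (ltnW (ltn_expl _ (ltnSn 1)))) // leq_exp2l.
Qed.

Hypothesis hT : contraction_for_large_distances T.

(** The distance |x - y| itself serves as eps. *)
Lemma contraction_for_large_distances_nonexpansive x y :
  `|T x - T y| <= `|x - y|.
Proof.
have [->|xy] := eqVneq x y; first by rewrite !subrr.
have d0 : 0 < `|x - y| by rewrite normr_gt0 subr_eq0.
have [K K1 /(_ x y (lexx _)) /le_trans] := hT d0; apply.
by rewrite ger_pMl // ltW.
Qed.

Lemma contraction_for_large_distances_fixpoint_uniq x y :
  T x = x -> T y = y -> x = y.
Proof.
move=> Tx Ty; apply/eqP; apply: contrapT => /negP xy.
have d0 : 0 < `|x - y| by rewrite normr_gt0 subr_eq0.
have [K K1 /(_ x y (lexx _))] := hT d0.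
by rewrite Tx Ty ler_pMl // leNgt K1.
Qed.

Context (x : nat -> X).
Hypothesis hx : forall n, x n.+1 = T (x n).

(** If every step had length at least [e], each iteration would shorten it by at least (1 - K) e,
    and the lengths would become negative. *)
Lemma contraction_for_large_distances_step e : 0 < e ->
  exists N, `|x N - x N.+1| < e.
Proof.
move=> e0; have [K K1 hK] := hT e0; apply: contrapT => nex.
have large n : e <= `|x n - x n.+1|.
  by rewrite leNgt; apply/negP => ?; apply: nex; exists n.
have dec n : `|x n - x n.+1| <= `|x 0%N - x 1%N| - n%:R * ((1 - K) * e).
  elim: n => [|n IH]; first by rewrite mul0r subr0.
  have := hK _ _ (large n); rewrite -!hx.
  have K1' : 0 <= 1 - K by lra.
  have := ler_wpM2l K1' (large n).
  rewrite -natr1; lra.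
have s0 : 0 < (1 - K) * e by rewrite mulr_gt0 // subr_gt0.
have b0 : 0 <= `|x 0%N - x 1%N| / ((1 - K) * e) by rewrite divr_ge0 // ltW.
have := archi_boundP b0; rewrite ltr_pdivrMr // => h.
have := le_trans (large _) (dec (Num.bound (`|x 0%N - x 1%N| / ((1 - K) * e)))).
lra.
Qed.

(* Meir-Keeler: once a step is short enough relative to [e], the ball of radius
   [e] around the current iterate is invariant under [T]. *)
Lemma contraction_for_large_distances_cvg : exists z, T z = z /\ x @ \oo --> z.
Proof.
have [z cz] : exists z : X, x @ \oo --> z.
  apply: cauchy_seq_cvg => e e0; have e2 : 0 < e / 2 by lra.
  have [K K1 hK] := hT e2.
  (* Points at distance at least e / 2 from x_N gain (1 - K) e / 2 under T, and closer ones stay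
     within e / 2; the first step must fit in either margin. *)
  have d0 : 0 < Num.min ((1 - K) * (e / 2)) (e / 2).
    by rewrite lt_min e2 mulr_gt0 // subr_gt0.
  have [N] := contraction_for_large_distances_step d0.
  rewrite lt_min => /andP[hd1 hd2]; exists N => n /subnK <-.
  elim: (n - N)%N => [|k IH]; first by rewrite subrr normr0 ltW.
  rewrite addSn hx.
  have := ler_distD (x N.+1) (x N) (T (x (k + N)%N)); rewrite {2}hx.
  have [far|/ltW near] := leP (e / 2) `|x N - x (k + N)%N|.
    have K1' : 0 <= 1 - K by lra.
    have := ler_wpM2l K1' far; have := hK _ _ far; lra.
  have := contraction_for_large_distances_nonexpansive (x N) (x (k + N)%N); lra.
exists z; split=> //; apply/eqP; rewrite -subr_eq0 -normr_le0.
apply/ler_addgt0Pr => e e0; rewrite add0r.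
have e2 : 0 < e / 2 by lra.
have /cvgrPdist_le /(_ _ e2) [N _ hN] := cz.
have h1 := hN N (leqnn N); have h2 := hN N.+1 (leqnSn N).
have := ler_distD (x N.+1) (T z) z; rewrite {1}hx (distrC (x N.+1)).
have := contraction_for_large_distances_nonexpansive z (x N).
move: h1 h2 => /=; lra.
Qed.

End ContractionForLargeDistances.

(** * The forward-backward operator *)

Section ForwardBackward.
Context {R : realType} {X : hilbertType R}.
Context (A B : X -> set X) (f : X -> X) (beta gamma : R).

(** Adjoining the pair (x, u) to the graph keeps it monotone. This is the form of maximality used
    for Minty's theorem. *)
Lemma maximally_monotone_related x u : maximally_monotone B ->
  (forall y v, B y v -> 0 <= inner (y - x) (v - u)) -> B x u.
Proof.
move=> [monB maxB] rel.
pose C : X -> set X := fun p => B p `|` [set q | p = x /\ q = u].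
have monC : Defs.monotone C.
  move=> p q s t; rewrite /gra /C /=.
  case=> [Bp|[-> ->]]; case=> [Bq|[-> ->]].
  - exact: monB Bp Bq.
  - exact: rel.
  - by rewrite -opprB innerNl -[u - t]opprB innerNr opprK; exact: rel.
  - by rewrite subrr inner0l.
have BC : gra B `<=` gra C by move=> p; left.
have : gra C (x, u) by right.
by rewrite (maxB _ monC BC).
Qed.

Hypothesis hB : maximally_monotone B.
Hypothesis gamma0 : 0 < gamma.

Lemma maximally_monotone_resolvent_ex w : exists p, B p (gamma^-1 *: (w - p)).
Proof.
have gN0 : gamma != 0 by rewrite gt_eqF.
have [monB _] := hB.
(* The operator here is gamma B - w. *)
have [] := @minty R X (fun y v => B y (gamma^-1 *: (w + v))).
- move=> y v y' v' h h'; have := monB _ _ _ _ h h'.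
  rewrite -scalerBr innerZr pmulr_rge0 ?invr_gt0 //.
  by rewrite opprD addrACA subrr add0r.
- move=> x u rel; apply: maximally_monotone_related => // y v Byv.
  have vE : gamma *: v - w - u = gamma *: (v - gamma^-1 *: (w + u)).
    by rewrite scalerBr scalerA mulfV // scale1r opprD addrA.
  have := rel y (gamma *: v - w).
  rewrite vE innerZr pmulr_rge0 // addrC subrK scalerA mulVf // scale1r.
  exact.
- by move=> p Bp; exists p.
Qed.

Hypothesis hA : forall x, A x = [set f x].

Let FB := op_comp (resolvent (op_scale gamma B))
                  (op_add op_id (op_scale (- gamma) A)).

Lemma forward_backward_graphE x p :
  FB x p <-> B p (gamma^-1 *: (x - gamma *: f x - p)).
Proof.
have gN0 : gamma != 0 by rewrite gt_eqF.
rewrite /FB /op_comp /resolvent /op_inv /op_add /op_scale /op_id hA; split.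
  move=> [_ /= [_ -> [_ [_ -> <-]] <-]] [_ -> [_ [b Bb <-]] e].
  by rewrite -scaleNr -e addrAC subrr add0r scalerA mulVf // scale1r.
move=> h; exists (x - gamma *: f x).
  exists x => //; exists (- gamma *: f x); last by rewrite scaleNr.
  by exists (f x).
exists p => //; exists (x - gamma *: f x - p); last by rewrite addrC subrK.
exists (gamma^-1 *: (x - gamma *: f x - p)) => //.
by rewrite scalerA mulfV // scale1r.
Qed.

(** The choice made by [get] lies in the set only if the set is nonempty, which Minty's theorem
    ensures. *)
Lemma forward_backward_graph x :
  B (forward_backward gamma A B x)
    (gamma^-1 *: (x - gamma *: f x - forward_backward gamma A B x)).
Proof.
apply/forward_backward_graphE; apply: getPex.
have [p Bp] := maximally_monotone_resolvent_ex (x - gamma *: f x).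
by exists p; apply/forward_backward_graphE.
Qed.

(** Two resolvent values q, p at w satisfy 0 <= <q - p, (w - q) - (w - p)> = - |q - p|^2. *)
Lemma forward_backward_eq x p : B p (gamma^-1 *: (x - gamma *: f x - p)) ->
  forward_backward gamma A B x = p.
Proof.
move=> Bp; have [monB _] := hB; have := monB _ _ _ _ (forward_backward_graph x) Bp.
rewrite -scalerBr innerZr pmulr_rge0 ?invr_gt0 //.
move: (forward_backward _ _ _ _) (x - _) => q w.
have -> : w - q - (w - p) = - (q - p) by rewrite !opprB addrC addrA subrK.
rewrite innerNr inner_norm oppr_ge0 => h.
have : `|q - p| == 0 by rewrite -sqrf_eq0; apply/eqP/le_anti; rewrite h sqr_ge0.
by rewrite normr_eq0 subr_eq0 => /eqP.
Qed.

Lemma zer_forward_backward z :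
  zer (op_add A B) z <-> forward_backward gamma A B z = z.
Proof.
have gN0 : gamma != 0 by rewrite gt_eqF.
have simp : gamma^-1 *: (z - gamma *: f z - z) = - f z.
  by rewrite addrAC subrr add0r scalerN scalerA mulVf // scale1r.
split.
  rewrite /zer /op_add /= hA => -[_ ->] [v Bv /eqP].
  rewrite addrC addr_eq0 => /eqP vE; apply: forward_backward_eq.
  by rewrite simp -vE.
move=> h; have := forward_backward_graph z; rewrite h simp => Bz.
by rewrite /zer /op_add /= hA; exists (f z) => //; exists (- f z) => //; rewrite subrr.
Qed.

Hypothesis hf : forall x y, beta * `|f x - f y| ^+ 2 <= inner (x - y) (f x - f y).
Hypothesis hgamma : gamma <= 2 * beta.

Lemma cocoercive_forward_nonexpansive x y :
  `|(x - gamma *: f x) - (y - gamma *: f y)| <= `|x - y|.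
Proof.
rewrite -(@ler_pXn2r _ 2) ?nnegrE //.
have -> : (x - gamma *: f x) - (y - gamma *: f y) = (x - y) - gamma *: (f x - f y).
  by rewrite scalerBr !opprB addrACA [RHS]addrACA; congr (_ + _); rewrite addrC.
have := hf x y; move: (x - y) (f x - f y) => d e h.
(* Cocoercivity bounds |d - gamma e|^2 by |d|^2 - gamma (2 beta - gamma) |e|^2. *)
rewrite -!inner_norm in h *; rewrite !innerE (innerC e d).
have ge : 0 <= inner e e by rewrite inner_norm sqr_ge0.
have := ler_wpM2l (ltW gamma0) h.
have : 0 <= gamma * (2 * beta - gamma) * inner e e.
  by rewrite !mulr_ge0 ?subr_ge0 // ltW.
lra.
Qed.

Context (phi : R -> \bar R).
Hypothesis hphi : forall x y u v : X, B x u -> B y v ->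
  (phi `|x - y|%R <= (inner (x - y)%R (u - v)%R)%:E)%E.

(** The real bound [c] replaces phi s, which may be infinite. *)
Lemma forward_backward_modulus (c : R) x y :
  let s := `|forward_backward gamma A B x - forward_backward gamma A B y| in
  (c%:E <= phi s)%E -> gamma * c <= s * (`|x - y| - s).
Proof.
move=> s /le_trans /(_ (hphi (forward_backward_graph x) (forward_backward_graph y))).
rewrite lee_fin -scalerBr innerZr -ler_pdivrMl ?invr_gt0 // invrK => /le_trans; apply.
have := cocoercive_forward_nonexpansive x y.
rewrite {}/s; move: (forward_backward _ _ _ x) (forward_backward _ _ _ y) => p q.
move: (x - gamma *: f x) (y - gamma *: f y) => u v h.
have -> : u - p - (v - q) = (u - v) - (p - q).
  by rewrite !opprB addrACA [RHS]addrACA; congr (_ + _); rewrite addrC.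
rewrite innerDr innerNr inner_norm mulrBr -expr2 lerB //.
apply: le_trans (cauchy_schwarz _ _) _; exact: ler_wpM2l.
Qed.

Lemma forward_backward_contraction : modulus phi ->
  contraction_for_large_distances (forward_backward gamma A B).
Proof.
move=> [phi_ge0 phi_nd phi0]; apply: contraction_for_large_distances_annulus.
move=> eps eps0; have e2 : 0 < eps / 2 by lra.
have [c c0 hc] : exists2 c : R, 0 < c & (c%:E <= phi (eps / 2))%E.
  have := phi_ge0 _ (ltW e2); have := phi0 _ (ltW e2).
  case: (phi (eps / 2)) => [r [h _]|_ _|_]; last by [].
    rewrite lee_fin le_eqVlt => /orP[/eqP r0|r0]; last by exists r.
    by have := h (congr1 _ (esym r0)); lra.
  by exists 1; rewrite ?leey.
have gc : 0 < gamma * c by rewrite mulr_gt0.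
have e4 : 0 < 4 * eps ^+ 2 by rewrite mulr_gt0 // exprn_gt0.
(* With d = |x - y| and s = |Tx - Ty|, the factor 1 / 2 covers s <= d / 2. Otherwise s >= eps / 2,
   so phi s >= c and gamma c <= s (d - s) <= d (d - s); then d <= 2 eps gives d - s >= d gamma c /
   (4 eps^2). *)
exists (Num.max (1 / 2) (1 - gamma * c / (4 * eps ^+ 2))).
  by rewrite gt_max; apply/andP; split; [lra | rewrite gtrBl divr_gt0].
move=> x y /andP[lb ub]; have d0 : 0 < `|x - y| by exact: lt_le_trans lb.
have := @forward_backward_modulus c x y; move: `|_ - _| (`|x - y|) lb ub d0 => s d lb ub d0 /= hs.
rewrite maxr_pMl ?(ltW d0) // le_max; apply/orP.
have [sd|/ltW sd] := leP s (1 / 2 * d); [by left | right].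
have {}hs : gamma * c <= s * (d - s).
  by apply: hs; apply: (le_trans hc); apply: phi_nd; lra.
have ds : 0 < d - s.
  by rewrite -(@pmulr_rgt0 _ s) ?(lt_le_trans gc hs) //; lra.
rewrite -(ler_pM2l e4) mulrA mulrBr mulr1 [X in _ - X]mulrC divfK ?gt_eqF //.
move: (gamma * c) gc hs => k k0 hs.
have h1 : d * k <= d ^+ 2 * (d - s).
  rewrite expr2 -mulrA ler_pM2l //; apply: le_trans hs _.
  by rewrite ler_pM2r //; lra.
have h2 : d ^+ 2 * (d - s) <= 4 * eps ^+ 2 * (d - s) by rewrite ler_pM2r //; nra.
lra.
Qed.

End ForwardBackward.

Theorem theorem8p7 (R : realType) (X : hilbertType R) (A B : X -> set X)
    (beta : R) (hA : maximally_monotone A) (hB : maximally_monotone B)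
    (hbeta : 0 < beta) (hAco : cocoercive beta A) (hBum : uniformly_monotone B)
    (gamma : R) (hgamma0 : 0 < gamma) (hgamma : gamma < 2 * beta)
    (x0 : X) (x : nat -> X) (hx0 : x 0%N = x0)
    (hx : forall n : nat, x n.+1 = forward_backward gamma A B (x n)) :
  [/\ exists z : X, zer (op_add A B) = [set z],
      contraction_for_large_distances (forward_backward gamma A B) &
      exists z : X, zer (op_add A B) = [set z] /\ x @ \oo --> z].
Proof.
have [f Af hf] := hAco; have [phi mphi hphi] := hBum.
have hT := forward_backward_contraction hB hgamma0 Af hf (ltW hgamma) hphi mphi.
(* The limit of the given orbit also supplies the existence of a zero. *)
have [z [Tz cz]] := contraction_for_large_distances_cvg hT hx.
have zE : zer (op_add A B) = [set z].
  apply/seteqP; split=> [y|_ ->]; last exact/(zer_forward_backward hB hgamma0 Af).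
  move=> /(zer_forward_backward hB hgamma0 Af) Ty.
  exact: contraction_for_large_distances_fixpoint_uniq hT _ _ Ty Tz.
by split=> //; exists z.
Qed.
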